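(* Let $R$ be a local ring. Then $R$ is a $2$-$\sqrt{J}U$ ring if and only if $R/J(R)\cong\mathbb{F}_2$ or $R/J(R)\cong\mathbb{F}_3$.
   Context: All rings are associative with identity $1\neq 0$. For a ring $R$, $J(R)$ denotes the Jacobson radical, $U(R)$ the group of units, and $\sqrt{J(R)}=\{x\in R : x^m\in J(R)\text{ for some } m\ge 1\}$. A ring $R$ is a $2$-$\sqrt{J}U$ ring if $u^2\in 1+\sqrt{J(R)}$ for every $u\in U(R)$. A ring $R$ is local if $R/J(R)$ is a division ring. $\mathbb{F}_q$ denotes the field with $q$ elements. *)

(* Defs.v *)
From HB Require Import structures.
From mathcomp Require Import all_boot all_order all_algebra.
From mathcomp Require Import boolp classical_sets.

Set Implicit Arguments.
Unset Strict Implicit.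
Unset Printing Implicit Defensive.

Import GRing.Theory.
Local Open Scope ring_scope.
Local Open Scope classical_set_scope.
Local Open Scope quotient_scope.

(* Rings are [nzRingType]: associative, unital, 1 != 0, not necessarily
   commutative, with no decidability assumption on units (which is why
   [GRing.unit] of [unitRingType] is not used). *)
Definition is_unit (R : nzRingType) (u : R) : Prop :=
  exists v : R, v * u = 1 /\ u * v = 1.

Definition left_ideal (R : nzRingType) (I : set R) : Prop :=
  [/\ I 0, forall x y, I x -> I y -> I (x + y) & forall a x, I x -> I (a * x)].

Definition maximal_left_ideal (R : nzRingType) (M : set R) : Prop :=
  [/\ left_ideal M, M <> setT &
      forall N, left_ideal N -> M `<=` N -> N = M \/ N = setT].

(* The intersection of all maximal left ideals, as a classically decided
   boolean predicate so that the library's quotients apply to it. *)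
Definition jacobson (R : nzRingType) : {pred R} :=
  fun x => `[< forall M : set R, maximal_left_ideal M -> M x >].

Arguments jacobson R : clear implicits.

Definition sqrt_jacobson (R : nzRingType) (x : R) : Prop :=
  exists m : nat, (1 <= m)%N /\ x ^+ m \in jacobson R.

Definition two_sqrtJU (R : nzRingType) : Prop :=
  forall u : R, is_unit u ->
    exists x : R, sqrt_jacobson x /\ u ^+ 2 = 1 + x.

Section JacobsonIdeal.
Variable R : nzRingType.
Implicit Types (M N : set R) (x y a : R).

Lemma jacobsonP x :
  reflect (forall M, maximal_left_ideal M -> M x) (x \in jacobson R).
Proof. exact: asboolP. Qed.

Lemma left_ideal1 M : left_ideal M -> M 1 -> M = setT.
Proof.
case=> _ _ MM M1; apply/seteqP; split=> // x _.
by rewrite -[x]mulr1; apply: MM.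
Qed.

Lemma maximal_left_ideal1 M : maximal_left_ideal M -> ~ M 1.
Proof. by case=> MI MT _ /(left_ideal1 MI). Qed.

Lemma exists_maximal_left_ideal : exists M, maximal_left_ideal M.
Proof.
pose P : set (set R) := [set A | [/\ ~ A 1,
  forall x y, A x -> A y -> A (x + y) & forall a x, A x -> A (a * x)]].
have [|M [[M1 MD MM] Mmax]] := @Zorn_bigcup R P.
  move=> F FP totF; split=> [[A FA]|x y [A FA Ax] [B FB By]|a x [A FA Ax]].
  - by have [] := FP _ FA.
  - have [AB|BA] := totF _ _ FA FB.
    + by exists B => //; have [_ BD _] := FP _ FB; apply: BD => //; apply: AB.
    + by exists A => //; have [_ AD _] := FP _ FA; apply: AD => //; apply: BA.
  - by exists A => //; have [_ _ AM] := FP _ FA; apply: AM.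
have M0 : M 0.
  apply: contrapT => nM0; apply: (Mmax [set 0]).
    split; last by move=> /(_ 0 erefl).
    by move=> x Mx; case: nM0; rewrite -[0](mul0r x); apply: MM.
  split=> [/eqP|x y -> ->|a x ->]; rewrite ?oner_eq0 ?addr0 ?mulr0 //.
exists M; split=> //; first by move=> MT; apply: M1; rewrite MT.
move=> N NI MN; case: (pselect (N 1)) => [/(left_ideal1 NI)|N1]; first by right.
left; apply: contrapT => NM; have [_ ND NMul] := NI; apply: (Mmax N) => //.
by split=> // NM'; apply: NM; apply/seteqP.
Qed.

Lemma jacobson_zmod_closed : zmod_closed (jacobson R).
Proof.
split=> [|x y /jacobsonP Jx /jacobsonP Jy]; apply/jacobsonP => M Mmax;
  have [[M0 MD MM] _ _] := Mmax => //.
by apply: MD; [exact: Jx | rewrite -mulN1r; apply: MM; exact: Jy].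
Qed.

HB.instance Definition _ :=
  GRing.isZmodClosed.Build R (jacobson R) jacobson_zmod_closed.

Lemma jacobsonMl a x : x \in jacobson R -> a * x \in jacobson R.
Proof.
move=> /jacobsonP Jx; apply/jacobsonP => M Mmax.
by have [[_ _ MM] _ _] := Mmax; apply: MM; apply: Jx.
Qed.

Lemma jacobsonMr a x : x \in jacobson R -> x * a \in jacobson R.
Proof.
move=> /jacobsonP Jx; apply/jacobsonP => M Mmax.
have [[M0 MD MM] _ Mm] := Mmax.
case: (pselect (M a)) => [Ma|nMa]; first exact: MM.
pose N : set R := [set y | M (y * a)].
apply: (Jx N); split.
- split=> [|y z My Mz|b y My]; rewrite /N /=.
  + by rewrite mul0r.
  + by rewrite mulrDl; apply: MD.
  + by rewrite -mulrA; apply: MM.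
- by move=> NT; apply: nMa; rewrite -[a]mul1r; have : N 1 by rewrite NT.
move=> K KI NK; have [K0 KD KM] := KI.
case: (pselect (K `<=` N)) => [KN|]; first by left; apply/seteqP.
move=> /existsNP[k /not_implyP[Kk nNk]]; right; apply: left_ideal1 => //.
pose L : set R := [set z | exists m b, M m /\ z = m + b * (k * a)].
have LI : left_ideal L.
  split=> [|_ _ [m [b [Mm' ->]]] [n [c [Mn ->]]]|c _ [m [b [Mm' ->]]]].
  - by exists 0, 0; rewrite mul0r addr0.
  - by exists (m + n), (b + c); rewrite mulrDl addrACA; split=> //; apply: MD.
  - by exists (c * m), (c * b); rewrite mulrDr mulrA; split=> //; apply: MM.
have ML : M `<=` L by move=> m Mm'; exists m, 0; rewrite mul0r addr0.
have Lka : L (k * a) by exists 0, 1; rewrite mul1r add0r.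
have [LM|LT] := Mm L LI ML; first by case: nNk; rewrite /N /= -LM.
have [m [b [Mm' aE]]] : L a by rewrite LT.
have : K (1 - b * k).
  apply: NK; rewrite /N /= mulrBl mul1r -mulrA {1}aE addrK //.
by move=> /KD /(_ (KM b k Kk)); rewrite subrK.
Qed.

Lemma jacobson1 : 1 \notin jacobson R.
Proof.
have [M Mmax] := exists_maximal_left_ideal.
by apply/negP => /jacobsonP /(_ M Mmax); apply: maximal_left_ideal1.
Qed.

End JacobsonIdeal.

(* The ring R / J(R).  The library equips quotients by additive subgroups with
   a Z-module structure, but provides the ring structure only for commutative
   rings; it is supplied here for the two-sided ideal J(R). *)
Definition quotJ (R : nzRingType) : Type := {ideal_quot (jacobson R)}.

Section QuotJ.
Variable R : nzRingType.
Local Notation Q := (quotJ R).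

HB.instance Definition _ := GRing.Zmodule.on Q.
HB.instance Definition _ : EqQuotient R (Quotient.equiv (jacobson R)) Q :=
  EqQuotient.on Q.
HB.instance Definition _ : isZmodQuotient R (Quotient.equiv (jacobson R))
  0 -%R +%R Q := ZmodQuotient.on Q.

Definition quotJ_one : Q := lift_cst Q 1.
Definition quotJ_mul := lift_op2 Q *%R.

Canonical pi_quotJ_one := PiConst quotJ_one.

Lemma pi_quotJ_mul : {morph \pi_Q : x y / x * y >-> quotJ_mul x y}.
Proof.
move=> x y; unlock quotJ_mul; apply/eqP; rewrite piE Quotient.equivE.
set x' := repr _; set y' := repr _.
have xx' : x - x' \in jacobson R by rewrite Quotient.idealrBE reprK.
have yy' : y - y' \in jacobson R by rewrite Quotient.idealrBE reprK.
rewrite -[x * y](subrK (x * y')) -addrA -mulrBr -mulrBl.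
by apply: rpredD; [exact: jacobsonMl | exact: jacobsonMr].
Qed.

Canonical pi_quotJ_mul_morph := PiMorph2 pi_quotJ_mul.

Lemma quotJ_mulA : associative quotJ_mul.
Proof. by move=> x y z; rewrite -[x]reprK -[y]reprK -[z]reprK !piE mulrA. Qed.

Lemma quotJ_mul1 : left_id quotJ_one quotJ_mul.
Proof. by move=> x; rewrite -[x]reprK !piE mul1r. Qed.

Lemma quotJ_mulr1 : right_id quotJ_one quotJ_mul.
Proof. by move=> x; rewrite -[x]reprK !piE mulr1. Qed.

Lemma quotJ_mulDl : left_distributive quotJ_mul +%R.
Proof.
by move=> x y z; rewrite -[x]reprK -[y]reprK -[z]reprK !piE mulrDl.
Qed.

Lemma quotJ_mulDr : right_distributive quotJ_mul +%R.
Proof.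
by move=> x y z; rewrite -[x]reprK -[y]reprK -[z]reprK !piE mulrDr.
Qed.

Lemma quotJ_one_neq0 : quotJ_one != 0.
Proof. by rewrite piE Quotient.equivE subr0 jacobson1. Qed.

HB.instance Definition _ := GRing.Zmodule_isNzRing.Build Q
  quotJ_mulA quotJ_mul1 quotJ_mulr1 quotJ_mulDl quotJ_mulDr quotJ_one_neq0.
HB.instance Definition _ := @isNzRingQuotient.Build R
  (Quotient.equiv (jacobson R)) 0 -%R +%R 1%R *%R Q (lock _) pi_quotJ_mul.

End QuotJ.

Definition is_division_ring (D : nzRingType) : Prop :=
  forall x : D, x != 0 -> is_unit x.

Definition is_local (R : nzRingType) : Prop := is_division_ring (quotJ R).

Definition ring_isomorphic (A B : nzRingType) : Prop :=
  exists f : {rmorphism A -> B}, bijective f.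

(* Main.v *)
Require Import Defs.
From mathcomp Require Import all_boot all_order all_algebra.
From HB Require Import structures.
From mathcomp Require Import boolp classical_sets.

(** Both conditions say that every nonzero element [q] of the division ring
    [D = R / J(R)] satisfies [q ^+ 2 = 1].

    By definition, [two_sqrtJU R] says that [u ^+ 2 - 1] is nilpotent modulo
    [J(R)] for every unit [u].  When [D] is a division ring, nilpotent means
    zero, and every nonzero element of [D] is the class of a unit of [R]: units
    lift modulo [J(R)] because [1 - x] is invertible for [x] in [J(R)]
    ([is_unit_pi]).  This gives [local_two_sqrtJU].

    If all nonzero elements of [D] square to [1], then
    [(q - 1) * (q + 1) = 0] leaves only [0], [1] and [-1] in [D].  Hence [D] is
    the prime field of characteristic [2] (when [1 = -1]) or [3] (otherwise);
    conversely the nonzero elements of ['F_2] and ['F_3] square to [1].  This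
    is [division_ring_sqr1]. *)

Set Implicit Arguments.
Unset Strict Implicit.
Unset Printing Implicit Defensive.

Import GRing.Theory.
Local Open Scope ring_scope.
Local Open Scope classical_set_scope.
Local Open Scope quotient_scope.

(** * Units modulo the Jacobson radical *)

Section JacobsonUnits.
Variable R : nzRingType.
Implicit Types (I M : set R) (x y u v w : R).

(** Krull's theorem: every proper left ideal lies in a maximal one. *)
Lemma exists_maximal_left_ideal_sup I : left_ideal I -> ~ I 1 ->
  exists2 M, maximal_left_ideal M & I `<=` M.
Proof.
move=> [I0 ID IM] I1.
(* The empty chain has union [set0], so [I] cannot be required to lie in the
   members of [P]: they are only required to stay proper once [I] is added. *)
pose P : set (set R) := [set A | [/\ forall a i, A a -> I i -> a + i <> 1,
  forall x y, A x -> A y -> A (x + y) & forall a x, A x -> A (a * x)]].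
have [|M [[M1 MD MM] Mmax]] := @Zorn_bigcup R P.
  move=> F FP totF.
  split=> [a i [A FA Aa]|x y [A FA Ax] [B FB By]|a x [A FA Ax]].
  - by have [A1 _ _] := FP _ FA; apply: A1.
  - have [AB|BA] := totF _ _ FA FB.
    + by exists B => //; have [_ BD _] := FP _ FB; apply: BD => //; apply: AB.
    + by exists A => //; have [_ AD _] := FP _ FA; apply: AD => //; apply: BA.
  - by exists A => //; have [_ _ AM] := FP _ FA; apply: AM.
(* The set [S = (M or 0) + I] is in [P], so maximality gives [I] inside [M]. *)
pose S : set R := [set z | exists m i, [/\ M m \/ m = 0, I i & z = m + i]].
have MS : M `<=` S.
  by move=> m Mm; exists m, 0; split=> //; [left|rewrite addr0].
have IS : I `<=` S.
  by move=> i Ii; exists 0, i; split=> //; [right|rewrite add0r].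
have PS : P S.
  split=> [_ j [m [i [Mm Ii ->]]] Ij|_ _ [m [i [Mm Ii ->]]] [n [j [Mn Ij ->]]]
          |a _ [m [i [Mm Ii ->]]]].
  - rewrite -addrA; case: Mm => [Mm|->]; first by apply: M1 => //; apply: ID.
    by rewrite add0r => ij1; apply: I1; rewrite -ij1; apply: ID.
  - exists (m + n), (i + j); rewrite addrACA; split=> //; last exact: ID.
    case: Mm Mn => [Mm|->] [Mn|->]; rewrite ?add0r ?addr0.
    + by left; apply: MD.
    + by left.
    + by left.
    + by right.
  - exists (a * m), (a * i); rewrite mulrDr; split=> //; last exact: IM.
    by case: Mm => [Mm|->]; [left; apply: MM|right; rewrite mulr0].
have SM : S `<=` M by apply: contrapT => nSM; apply: (Mmax S).
have IsubM : I `<=` M by move=> i /IS /SM.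
have nM1 : ~ M 1 by move=> M1'; apply: (M1 1 0); rewrite ?addr0.
exists M => //; split=> [|MT|N NI MN].
- by split=> //; apply: IsubM.
- by apply: nM1; rewrite MT.
case: (pselect (N 1)) => [/(left_ideal1 NI)|N1]; first by right.
left; apply: contrapT => NM; have [N0 ND NMul] := NI; apply: (Mmax N).
  by split=> // NM'; apply: NM; apply/seteqP.
split=> // a i Na Ii ai1; apply: N1; rewrite -ai1.
by apply: ND => //; apply: MN; apply: IsubM.
Qed.

(** The left ideal generated by [1 - x] is not proper: a maximal left ideal
    above it would contain [x], hence [1]. *)
Lemma jacobson_linv x : x \in jacobson R -> exists v, v * (1 - x) = 1.
Proof.
move=> /jacobsonP Jx; apply: contrapT => nv.
pose I : set R := [set z | exists v, z = v * (1 - x)].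
have [||M Mmax IM] := @exists_maximal_left_ideal_sup I.
- split=> [|_ _ [v ->] [w ->]|a _ [v ->]].
  + by exists 0; rewrite mul0r.
  + by exists (v + w); rewrite mulrDl.
  + by exists (a * v); rewrite mulrA.
- by case=> v v1; apply: nv; exists v.
have [[_ MD _] _ _] := Mmax; apply: (maximal_left_ideal1 Mmax).
rewrite -[1](subrK x); apply: MD; last exact: Jx.
by apply: IM; exists 1; rewrite mul1r.
Qed.

Lemma is_unit_1subr x : x \in jacobson R -> is_unit (1 - x).
Proof.
move=> Jx; have [v v1] := jacobson_linv Jx.
(* The left inverse [v] is again of the form [1 - y] with [y] in the radical,
   hence has a left inverse of its own. *)
have vE : v = 1 - - (v * x).
  by move: v1; rewrite mulrBr mulr1 opprK => <-; rewrite subrK.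
have [w w1] : exists w, w * v = 1.
  by rewrite vE; apply: jacobson_linv; rewrite rpredN jacobsonMl.
exists v; split=> //.
suff -> : 1 - x = w by [].
by rewrite -[1 - x]mul1r -{1}w1 -mulrA v1 mulr1.
Qed.

Lemma is_unit_lrinv x v w : v * x = 1 -> x * w = 1 -> is_unit x.
Proof.
move=> vx xw; exists v; split=> //.
by rewrite -[v]mulr1 -{1}xw (mulrA v) vx mul1r.
Qed.

Lemma pi_quotJ_eq x y :
  (\pi_(quotJ R) x = \pi_(quotJ R) y) <-> (x - y \in jacobson R).
Proof.
have E : (\pi_(quotJ R) x == \pi_(quotJ R) y) = (x - y \in jacobson R).
  by rewrite piE Quotient.equivE.
by rewrite -E; split=> [/eqP|/eqP].
Qed.

(** Units lift modulo the Jacobson radical. *)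
Lemma is_unit_pi u : is_unit (\pi_(quotJ R) u) <-> is_unit u.
Proof.
split=> [[q []]|[v [vu uv]]]; last first.
  by exists (\pi_(quotJ R) v); rewrite -!rmorphM vu uv rmorph1.
rewrite -[q]reprK -!rmorphM -(rmorph1 \pi_(quotJ R)); set v := repr q.
(* If [v] represents the inverse of the class of [u], then [v * u] and [u * v]
   are both congruent to [1], hence units. *)
move=> /esym/pi_quotJ_eq/is_unit_1subr.
rewrite opprB addrC subrK => -[a [a1 _]].
move=> /esym/pi_quotJ_eq/is_unit_1subr.
rewrite opprB addrC subrK => -[b [_ b1]].
apply: (@is_unit_lrinv _ (a * v) (v * b)); first by rewrite -mulrA.
by rewrite mulrA.
Qed.

End JacobsonUnits.

(** * Division rings whose nonzero elements square to one *)

Section DivisionRing.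
Variable D : nzRingType.
Hypothesis Ddiv : is_division_ring D.
Implicit Types q r : D.

Lemma division_ring_mulf_eq0 q r : q * r = 0 -> q = 0 \/ r = 0.
Proof.
move=> qr0; have [->|/Ddiv[v [vq _]]] := eqVneq q 0; [by left|right].
by rewrite -[r]mul1r -vq -mulrA qr0 mulr0.
Qed.

Lemma division_ring_nilp_eq0 q m : q ^+ m = 0 -> q = 0.
Proof.
elim: m => [/eqP|m IHm]; first by rewrite expr0 oner_eq0.
by rewrite exprS => /division_ring_mulf_eq0[].
Qed.

Lemma division_ring_sqr1_pm1 q : q ^+ 2 = 1 -> q = 1 \/ q = -1.
Proof.
move=> q2; have : (q - 1) * (q + 1) = 0.
  by rewrite mulrDr mulr1 mulrBl mul1r -expr2 q2 addrA subrK subrr.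
case/division_ring_mulf_eq0 => /eqP; first by rewrite subr_eq0 => /eqP; left.
by rewrite addr_eq0 => /eqP; right.
Qed.

End DivisionRing.

(** The map from the field with [p] elements, for [p] prime, sending the class
    of [n < p] to [n%:R]; it is a ring morphism when [D] has characteristic [p]. *)
Definition Fp_to (D : nzRingType) (p : nat) (x : 'F_p) : D := (val x)%:R.

Section PrimeRing.
Variables (D : nzRingType) (p : nat).
Hypothesis Dp : p \in [pchar D].

Let p_prime : prime p := pcharf_prime Dp.

Lemma Fp_to_nat n : Fp_to D (n%:R : 'F_p) = n%:R.
Proof. by rewrite /Fp_to /= val_Fp_nat // GRing.natr_mod_pchar. Qed.

Lemma Fp_to_is_nmod_morphism : nmod_morphism (@Fp_to D p).
Proof.
split=> [|x y]; first by rewrite -[0](mulr0n 1) Fp_to_nat.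
by rewrite -[x]natr_Zp -[y]natr_Zp -natrD !Fp_to_nat natrD.
Qed.

Lemma Fp_to_is_monoid_morphism : monoid_morphism (@Fp_to D p).
Proof.
split=> [|x y]; first by rewrite -[1](mulr1n 1) Fp_to_nat.
by rewrite -[x]natr_Zp -[y]natr_Zp -natrM !Fp_to_nat natrM.
Qed.

(** A ring of characteristic [p] that is generated by [1] as an additive group
    is the field with [p] elements. *)
Lemma ring_isomorphic_Fp :
  (forall q : D, exists n : nat, q = n%:R) -> ring_isomorphic D 'F_p.
Proof.
move=> Dnat.
pose g : {rmorphism 'F_p -> D} := HB.pack (@Fp_to D p)
  (GRing.isNmodMorphism.Build _ _ _ Fp_to_is_nmod_morphism)
  (GRing.isMonoidMorphism.Build _ _ _ Fp_to_is_monoid_morphism).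
pose f (q : D) : 'F_p := (projT1 (cid (Dnat q)))%:R.
have fK : cancel f g.
  by move=> q; rewrite /f; case: cid => n /= ->; exact: Fp_to_nat.
have gK : cancel g f by move=> x; apply: (fmorph_inj g); rewrite fK.
pose f' : {rmorphism D -> 'F_p} := HB.pack f
  (GRing.isZmodMorphism.Build _ _ _ (can2_zmod_morphism gK fK))
  (GRing.isMonoidMorphism.Build _ _ _ (can2_monoid_morphism gK fK)).
by exists f', g.
Qed.

End PrimeRing.

Lemma F2_sqr1 (x : 'F_2) : x != 0 -> x ^+ 2 = 1.
Proof. by case: x => [[|[|//]] ?] // _; apply: val_inj. Qed.

Lemma F3_sqr1 (x : 'F_3) : x != 0 -> x ^+ 2 = 1.
Proof. by case: x => [[|[|[|//]]] ?] // _; apply: val_inj. Qed.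

Lemma ring_isomorphic_sqr1 (A B : nzRingType) : ring_isomorphic A B ->
  (forall b : B, b != 0 -> b ^+ 2 = 1) -> forall a : A, a != 0 -> a ^+ 2 = 1.
Proof.
move=> [f /bij_inj f_inj] B1 a a0; apply: (f_inj _ _).
by rewrite rmorphXn rmorph1 B1 // -(rmorph0 f) (inj_eq f_inj).
Qed.

Lemma division_ring_sqr1 (D : nzRingType) : is_division_ring D ->
  (forall q : D, q != 0 -> q ^+ 2 = 1) <->
  ring_isomorphic D 'F_2 \/ ring_isomorphic D 'F_3.
Proof.
move=> Ddiv; split=> [D1|[isoD|isoD]]; last 2 first.
- exact: ring_isomorphic_sqr1 isoD F2_sqr1.
- exact: ring_isomorphic_sqr1 isoD F3_sqr1.
have Dpm (q : D) : [\/ q = 0, q = 1 | q = -1].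
  have [->|q0] := eqVneq q 0; first exact: Or31.
  case: (division_ring_sqr1_pm1 Ddiv (D1 q q0)) => ->.
  - exact: Or32.
  - exact: Or33.
have [N1|N1] := eqVneq (1 : D) (-1).
  left; apply: ring_isomorphic_Fp => [|q].
    by rewrite inE /= mulr2n {2}N1 subrr.
  case: (Dpm q) => ->; first by exists 0%N.
    by exists 1%N.
  by exists 1%N; rewrite -N1.
(* Now [1 + 1] is neither [0] (as [1 != -1]) nor [1], so it is [-1]. *)
have D2 : 2%:R = -1 :> D.
  case: (Dpm 2%:R) => // /eqP; rewrite mulr2n.
    by rewrite addr_eq0 (negPf N1).
  by rewrite -subr_eq0 addrK oner_eq0.
right; apply: ring_isomorphic_Fp => [|q].
  by rewrite inE /= mulrS D2 subrr.
case: (Dpm q) => ->; first by exists 0%N.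
  by exists 1%N.
by exists 2%N.
Qed.

(** * Local rings *)

Lemma local_two_sqrtJU (R : nzRingType) : is_local R ->
  two_sqrtJU R <-> (forall q : quotJ R, q != 0 -> q ^+ 2 = 1).
Proof.
move=> Rloc; split=> [RU q q0|Q1 u /is_unit_pi[q [qu _]]].
  have /is_unit_pi/RU[x [[m [_ Jxm]] uE]] : is_unit (\pi_(quotJ R) (repr q)).
    by rewrite reprK; apply: Rloc.
  have x0 : \pi_(quotJ R) x = 0.
    apply: (@division_ring_nilp_eq0 _ Rloc _ m).
    rewrite -rmorphXn -(rmorph0 \pi_(quotJ R)); apply/pi_quotJ_eq.
    by rewrite subr0.
  by rewrite -[q]reprK -rmorphXn uE rmorphD rmorph1 [X in _ + X]x0 addr0.
exists (u ^+ 2 - 1); split; last by rewrite [RHS]addrC subrK.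
exists 1%N; split=> //.
rewrite expr1; apply/pi_quotJ_eq; rewrite rmorphXn rmorph1 Q1 //.
by apply: contra_eq_neq qu => ->; rewrite mulr0 eq_sym oner_neq0.
Qed.

Theorem corollary2p12 (R : nzRingType) (hR : is_local R) :
  two_sqrtJU R <->
  ring_isomorphic (quotJ R) 'F_2 \/ ring_isomorphic (quotJ R) 'F_3.
Proof. by rewrite (local_two_sqrtJU hR); exact: division_ring_sqr1. Qed.
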